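(* Assume that $2^\kappa < 2^{\kappa^+}$ for every cardinal $\kappa$. Let $X$ be a compact $T_5$ space. Then $dis(X) \geq \Delta(X)$.
   Context: All spaces are Hausdorff. A $T_5$ space is a hereditarily normal (Hausdorff) space, i.e. every subspace is normal. $dis(X)$ denotes the least number of discrete sets required to cover $X$ (a subset of $X$ is discrete if its subspace topology is discrete; it need not be closed in $X$). $\Delta(X)$ denotes the least cardinality of a nonempty open subset of $X$ (for nonempty $X$). *)

(* Defs.v *)
From mathcomp Require Import all_boot all_order all_algebra.
From mathcomp Require Import all_classical all_reals all_analysis.

Set Implicit Arguments.
Unset Strict Implicit.
Unset Printing Implicit Defensive.

Local Open Scope classical_set_scope.
Local Open Scope card_scope.

(* A cardinal is represented by any type of that cardinality; cardinals are
   compared through injections.  Naming the universe once makes all cardinals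
   below, including those of sets of points of a space, range over the same
   universe. *)
Definition cardinal := Type.

Definition card_leq (K L : cardinal) : Prop := [set: K] #<= [set: L].

Definition card_ltn (K L : cardinal) : Prop :=
  card_leq K L /\ ~ card_leq L K.

(* [L] is $K^+$, the least cardinal greater than [K]. *)
Definition is_succ_card (K L : cardinal) : Prop :=
  card_ltn K L /\ forall M : cardinal, card_ltn K M -> card_leq L M.

(* $2^K$ *)
Definition pow2 (K : cardinal) : cardinal := set K.

Section LeastCardinality.
Context {T : Type}.
Implicit Types F : set (set T).

Definition least_card_set F : set T :=
  get [set A | F A /\ forall B, F B -> A #<= B].

(* The least cardinality of a member of [F], when [F] is nonempty. *)
Definition least_card F : cardinal := set_type (least_card_set F).

Lemma exists_least_card F : F !=set0 ->
  exists2 A, F A & forall B, F B -> A #<= B.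
Proof.
move=> [A0 FA0].
pose P (Z : set (set T -> T)) :=
  (forall f A, Z f -> F A -> A (f A)) /\
  (forall f g A, Z f -> Z g -> F A -> f A = g A -> f = g).
have [|Z [[Zin Zinj] Zmax]] := @Zorn_bigcup _ P.
  move=> G GP Gtot; split.
    by move=> f A [Z GZ Zf] FA; have [inZ _] := GP _ GZ; exact: (inZ f A Zf FA).
  move=> f g A [Z1 G1 Zf] [Z2 G2 Zg] FA fg.
  have [Z12|Z21] := Gtot _ _ G1 G2.
    by have [_ inj2] := GP _ G2; exact: (inj2 f g A (Z12 _ Zf) Zg FA fg).
  by have [_ inj1] := GP _ G1; exact: (inj1 f g A Zf (Z21 _ Zg) FA fg).
have [[A [FA AZ]]|noA] :=
    pselect (exists A, F A /\ A `<=` (fun f : set T -> T => f A) @` Z).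
  exists A => // B FB.
  apply: (@card_le_trans _ _ _ Z).
    apply: (card_le_trans (subset_card_le AZ)); exact: card_image_le.
  have /injfunPex[h] : exists2 h : (set T -> T) -> T, set_fun Z B h & set_inj Z h.
    exists (fun f => f B); first by move=> f Zf; exact: (Zin f B Zf FB).
    by move=> f g /set_mem Zf /set_mem Zg fg; exact: (Zinj f g B Zf Zg FB fg).
  exact: inj_card_le.
have new A : F A -> exists t, A t /\ forall f, Z f -> f A <> t.
  move=> FA; apply: contrapT => nt; apply: noA; exists A; split => // t At.
  apply: contrapT => nZt; apply: nt; exists t; split => // f Zf fAt.
  by apply: nZt; exists f.
have [t0 _] := new _ FA0.
have /choice[h hP] : forall A, exists t,
    F A -> A t /\ forall f, Z f -> f A <> t.
  move=> A; have [FA|nFA] := pselect (F A); last by exists t0.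
  by have [t tP] := new _ FA; exists t.
exfalso; apply: (Zmax (Z `|` [set h])).
  rewrite properEneq; split; last exact: subsetUl.
  apply/eqP => ZE; have Zh : Z h by rewrite ZE; right.
  by have [_ /(_ h Zh)] := hP _ FA0; apply.
split.
  by move=> f A [Zf|->] FA; [exact: (Zin f A Zf FA)|have [] := hP _ FA].
move=> f g A [Zf|->] [Zg|->] FA fg //.
- exact: (Zinj f g A Zf Zg FA fg).
- by have [_ /(_ f Zf)] := hP _ FA.
- by have [_ /(_ g Zg)] := hP _ FA; rewrite fg.
Qed.

Lemma least_card_setP F : F !=set0 ->
  F (least_card_set F) /\ forall B, F B -> least_card_set F #<= B.
Proof.
move=> /exists_least_card[A FA Amin].
by apply: (getPex (P := [set A | F A /\ forall B, F B -> A #<= B])); exists A.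
Qed.

End LeastCardinality.

(* On [set_type A] the library puts the subspace topology (whereas
   [subspace A] is a topology on all of [X] isolating the points outside [A]). *)
Definition T5_space (X : topologicalType) : Prop :=
  hausdorff_space X /\ forall A : set X, normal_space (set_type A).

Definition discrete_set (X : topologicalType) (D : set X) : Prop :=
  forall B : set (set_type D), open B.

Definition discrete_covers (X : topologicalType) : set (set (set X)) :=
  [set C | (forall D, C D -> discrete_set D) /\ \bigcup_(D in C) D = [set: X]].

Definition dis (X : topologicalType) : cardinal :=
  least_card (@discrete_covers X).

(* Meaningful for nonempty [X] only. *)
Definition Delta (X : topologicalType) : cardinal :=
  least_card [set U : set X | open U /\ U !=set0].

(* Main.v *)
Require Import Defs.
From mathcomp Require Import all_boot all_order all_algebra.
From mathcomp Require Import all_classical all_reals all_analysis.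

(** Let [C] be a cover of [X] by discrete sets, of least cardinality, and
suppose for contradiction that every nonempty open set has more than [|C|]
points.

If [C] is finite, removing the members of [C] one after the other from an open
set ends at an isolated point ([finite_discrete_cover_isolated]), that is, at
an open set with a single point.

Let [C] be infinite.  Two facts of independent nature are combined.

- Compactness gives a nonempty open set [U] contained in the closure of a set
  [P] of at most [|C|] points ([small_dense_open]).  Indeed, if no set of at
  most [|C|] points were dense in a nonempty open set, one could choose
  nonempty open sets [U 0], [U 1], ... whose closures decrease, the closure of
  [U n.+1] avoiding at most [|C|] prescribed points of the closure of [U n].
  The points to avoid are the members of the finite sets which are cut out of
  the closure of [U n] by a member of [C] together with finitely many
  remainders, the remainder of a discrete set [D] being the closed set
  [closure D `\` D].  By compactness, some point [x] lies in all these closures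
  and in the remainders of a maximal family of members of [C].  It lies in some
  [D] in [C], and maximality and compactness show that [x] was to be avoided at
  a finite stage ([descent_escapes_cover]).

- Hereditary normality gives a form of Jones' lemma: if [P] is dense in the
  open set [U] and [D] is discrete, then [2^|D `&` U| <= 2^|P|]
  ([discrete_density]).  The part of [D] inside [U] is closed and discrete in
  the open subspace of [U] obtained by deleting its remainder, so each of its
  subsets [S] extends to an open set whose closure misses the rest of it, and
  the trace on [P] of that open set determines [S].

As [2^|C| < 2^(|C|^+)], every member of [C] meets [U] in at most [|C|] points;
there are [|C|] of them and they cover [U], so [U] has at most [|C|] points, a
contradiction.  The counting uses that an infinite cardinal is equal to its
square ([card_square]) and that any two cardinals are comparable
([card_le_total]). *)

Local Open Scope classical_set_scope.

(** * Comparison of cardinals *)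

Lemma card_le_inj {T U : Type} (A : set T) (f : T -> U) :
  set_inj A f -> (A #<= [set: U])%card.
Proof.
move=> /inj_card_eq; rewrite card_eq_le => /andP[_ AfA].
exact: card_le_trans AfA (card_leT _).
Qed.

Lemma card_le_injP {T U : Type} (A : set T) (B : set U) (u : U) :
  (A #<= B)%card -> exists2 f : T -> U, set_fun A B f & set_inj A f.
Proof.
elim/Ppointed: U => U in B u *; first by case: (no u).
by move=> /pcard_leP /injfunPex.
Qed.

(** Both sets are members of one family of subsets of the sum type, and a
family of sets has a member of least cardinality. *)
Lemma card_le_total {T U : Type} (A : set T) (B : set U) :
  (A #<= B)%card \/ (B #<= A)%card.
Proof.
pose A' := @inl T U @` A; pose B' := @inr T U @` B.
have eqA : (A' #= A)%card by apply: inj_card_eq => x y _ _ [].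
have eqB : (B' #= B)%card by apply: inj_card_eq => x y _ _ [].
have [C [->|->] Cmin] :=
  @exists_least_card _ [set A'; B'] (ex_intro _ A' (or_introl erefl)).
- by left; rewrite -(card_le_eql eqA) -(card_le_eqr eqB); apply: Cmin; right.
- by right; rewrite -(card_le_eql eqB) -(card_le_eqr eqA); apply: Cmin; left.
Qed.

(** The successor of [K] is realized by a subset of [T] of least cardinality
among those that do not inject into [K]. *)
Lemma card_le_succ_within {T K : Type} (A : set T) :
  ~ (A #<= [set: K])%card ->
  exists B : set T, is_succ_card K (set_type B) /\ (B #<= A)%card.
Proof.
move=> nAK; have [B nBK Bmin] :=
  @exists_least_card _ [set B : set T | ~ (B #<= [set: K])%card]
    (ex_intro _ A nAK).
have not_le M : ~ card_leq M K -> card_leq (set_type B) M.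
  move=> nMK; have [//|] := card_le_total [set: set_type B] [set: M].
  have [b0 _] : [set: T] !=set0.
    apply/set0P/eqP => T0; apply: nAK.
    have -> : A = set0 by rewrite -subset0 -T0.
    exact: card_ge0.
  rewrite (card_le_eqr (card_setT B)) => /(card_le_injP _ _ b0)[h hB hinj].
  rewrite /card_leq (card_le_eql (card_setT B)).
  have eqh : (h @` [set: M] #= [set: M])%card by exact: inj_card_eq.
  rewrite -(card_le_eqr eqh); apply: Bmin => /=.
  by rewrite (card_le_eql eqh).
exists B; split; last exact: Bmin.
have nB : ~ card_leq (set_type B) K.
  by rewrite /card_leq (card_le_eql (card_setT B)).
split; last by move=> M [_]; exact: not_le.
split => //.
by have [] := card_le_total [set: K] [set: set_type B].
Qed.

Lemma card_leq_pow2 {K L : Type} : card_leq K L -> card_leq (pow2 K) (pow2 L).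
Proof.
move=> KL; apply/card_leP; have [L0|/set0P[l0 _]] := eqVneq [set: L] set0.
  have K0 (k : K) : False.
    move: KL; rewrite /card_leq L0 => /card_le0P K0.
    by have : set0 k by rewrite -K0.
  apply/card_leP; apply: (@card_le_inj _ _ _ (fun=> set0)) => A B _ _ _.
  by apply/funext => k; case: (K0 k).
have [f _ finj] := card_le_injP _ _ l0 KL.
apply/card_leP; apply: (@card_le_inj _ _ _ (fun A => f @` A)) => A B _ _.
suff sub (S S' : set K) : f @` S = f @` S' -> S `<=` S'.
  by move=> eqf; apply/seteqP; split; apply: sub.
move=> eqf x Sx; have [y S'y fyx] : (f @` S') (f x) by rewrite -eqf; exists x.
by have -> : x = y by apply: finj; rewrite ?inE.
Qed.

(** * The square of an infinite cardinal *)

Section Square.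
Context {K : Type}.
Implicit Types (Z : set (K * K * K)).

(** An injection from the square of a subset of [K] to that subset is encoded
by its graph, so that a chain of such injections has its union as an upper
bound; the subset is recovered from the diagonal of its square. *)
Definition pairing_base Z : set K := [set a | exists c, Z (a, a, c)].

Definition pairing_graph Z : Prop :=
  [/\ forall a b c c', Z (a, b, c) -> Z (a, b, c') -> c = c',
      forall a b a' b' c, Z (a, b, c) -> Z (a', b', c) -> (a, b) = (a', b'),
      forall a b c, Z (a, b, c) ->
        [/\ pairing_base Z a, pairing_base Z b & pairing_base Z c] &
      forall a b, pairing_base Z a -> pairing_base Z b ->
        exists c, Z (a, b, c)].

Lemma pairing_graph_bigcup (F : set (set (K * K * K))) :
  F `<=` pairing_graph -> total_on F subset ->
  pairing_graph (\bigcup_(Z in F) Z).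
Proof.
move=> FP Ftot.
have two z1 z2 : (\bigcup_(Z in F) Z) z1 -> (\bigcup_(Z in F) Z) z2 ->
    exists Z, [/\ F Z, Z z1 & Z z2].
  move=> [Z1 F1 Zz1] [Z2 F2 Zz2].
  have [Z12|Z21] := Ftot _ _ F1 F2.
    by exists Z2; split => //; exact: Z12.
  by exists Z1; split => //; exact: Z21.
split.
- move=> a b c c' /two/[apply] -[Z [FZ Z1 Z2]].
  by have [fu _ _ _] := FP _ FZ; exact: fu Z1 Z2.
- move=> a b a' b' c /two/[apply] -[Z [FZ Z1 Z2]].
  by have [_ inj _ _] := FP _ FZ; exact: inj Z1 Z2.
- move=> a b c [Z FZ Zabc]; have [_ _ sub _] := FP _ FZ.
  by have [[x Zx] [y Zy] [z Zz]] := sub _ _ _ Zabc; split;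
    [exists x|exists y|exists z]; exists Z.
- move=> a b [x Ux] [y Uy]; have [Z [FZ Z1 Z2]] := two _ _ Ux Uy.
  have [_ _ _ tot] := FP _ FZ.
  by have [||c Zc] := tot a b; [exists x|exists y|exists c; exists Z].
Qed.

(** The union is disjoint on both sides: the new pairs are those that are not
in the square of the old base, and their values lie outside the old base. *)
Lemma pairing_graph_extend {Z} {D : set K} {g : K -> K -> K} :
  pairing_graph Z -> pairing_base Z `<=` D ->
  let A := pairing_base Z in
  (forall x y, D x -> D y -> ~ (A x /\ A y) -> (D `\` A) (g x y)) ->
  (forall x y x' y', D x -> D y -> ~ (A x /\ A y) ->
    D x' -> D y' -> ~ (A x' /\ A y') -> g x y = g x' y' -> (x, y) = (x', y')) ->
  pairing_graph (Z `|`
    [set z | [/\ D z.1.1, D z.1.2, ~ (A z.1.1 /\ A z.1.2) &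
                 z.2 = g z.1.1 z.1.2]]).
Proof.
move=> [fu inj sub tot] AD A gD ginj; set Z' := _ `|` _.
have DZ' a : D a -> pairing_base Z' a.
  move=> Da; have [Aa|nAa] := pselect (A a).
    by have [c Zc] := Aa; exists c; left.
  by exists (g a a); right; split => // -[].
have Z'D a : pairing_base Z' a -> D a.
  by move=> [c [Zc|[]//]]; apply: AD; exists c.
split.
- move=> a b c c' [Zc|[/= Da Db nAab ->]] [Zc'|[/= Da' Db' nAab' ->]] //.
  + exact: fu Zc Zc'.
  + by have [? ? _] := sub _ _ _ Zc; case: nAab'.
  + by have [? ? _] := sub _ _ _ Zc'; case: nAab.
- move=> a b a' b' c [Zc|[/= Da Db nAab ->]] [Zc'|[/= Da' Db' nAab' eqg]].
  + exact: inj Zc Zc'.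
  + have [_ _ Ac] := sub _ _ _ Zc.
    by have [_ []] := gD _ _ Da' Db' nAab'; rewrite -eqg.
  + have [_ _ Ac] := sub _ _ _ Zc'.
    by have [_ []] := gD _ _ Da Db nAab.
  + exact: ginj eqg.
- move=> a b c [Zc|[/= Da Db nAab ->]].
    have [[x Zx] [y Zy] [z Zz]] := sub _ _ _ Zc.
    by split; [exists x|exists y|exists z]; left.
  by split; apply: DZ' => //; have [] := gD _ _ Da Db nAab.
- move=> a b /Z'D Da /Z'D Db.
  have [[Aa Ab]|nAab] := pselect (A a /\ A b).
    by have [c Zc] := tot a b Aa Ab; exists c; left.
  by exists (g a b); right; split.
Qed.

(** A pairing with infinite base: the maximal graph of [card_square] is required
to contain it. *)
Lemma pairing_graph_nat (e : nat -> K) : injective e ->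
  pairing_graph (range (fun m : nat * nat =>
    (e m.1, e m.2, e (choice.pickle m)))).
Proof.
move=> einj; set Z := range _.
have base n : pairing_base Z (e n).
  by exists (e (choice.pickle (n, n))), (n, n).
split.
- by move=> a b c c' [[m n] _ [<- <- <-]] [[m' n'] _ [/einj-> /einj-> <-]].
- move=> a b a' b' c [[m n] _ [<- <- <-]] [[m' n'] _ [<- <-]].
  by move=> /einj /(pcan_inj choice.pickleK)[-> ->].
- by move=> a b c [[m n] _ [<- <- <-]]; split; exact: base.
- move=> a b [_ [[m m'] _ [<- _ _]]] [_ [[n n'] _ [<- _ _]]].
  by exists (e (choice.pickle (m, n))), (m, n).
Qed.

(** Take a maximal pairing graph, with base [A].  If [K] minus [A] is no larger
than [A], then [K] injects into [A], and the pairing of [A] gives one of [K].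
Otherwise [K] minus [A] contains a copy [B] of [A], and the pairing extends to
the union of [A] and [B], against maximality: the pairs that are not in the
square of [A] are sent injectively to [B] because [A] has room for several
copies of its own square. *)
Lemma card_square : infinite_set [set: K] ->
  ([set: K * K] #<= [set: K])%card.
Proof.
move=> Kinf.
have [k0 _] : [set: K] !=set0.
  by apply/set0P/eqP => K0; apply: Kinf; rewrite K0.
have /infiniteP/(card_le_injP _ _ k0)[e _ einj] := Kinf.
have {}einj : injective e by move=> m n; apply: einj; rewrite in_setT.
set Z0 := range (fun m : nat * nat => (e m.1, e m.2, e (choice.pickle m))).
(* The condition on [Z0] is void for the empty graph, the union of the empty
chain. *)
have [|Z [[PZ Z0Z] Zmax]] :=
    @Zorn_bigcup _ [set Z | pairing_graph Z /\ (Z !=set0 -> Z0 `<=` Z)].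
  move=> F FP Ftot; split.
    by apply: pairing_graph_bigcup => // Z /FP[].
  move=> [z [Z FZ Zz]]; apply: (@subset_trans _ Z); last exact: bigcup_sup.
  by have [_] := FP _ FZ; apply; exists z.
have {}Z0Z : Z0 `<=` Z.
  apply: Z0Z; apply: contrapT => Z_0; apply: (Zmax Z0).
    split; first by move=> z Zz; case: Z_0; exists z.
    move=> Z0Z; apply: Z_0; exists (e 0, e 0, e (choice.pickle (0, 0))).
    by apply: Z0Z; exists (0, 0).
  by split=> [|_ z //]; exact: pairing_graph_nat einj.
have [fu inj sub tot] := PZ.
pose A := pairing_base Z.
have Ae n : A (e n).
  by exists (e (choice.pickle (n, n))); apply: Z0Z; exists (n, n).
have /choice[f fP] : forall p : K * K, exists c,
    A p.1 -> A p.2 -> Z (p.1, p.2, c).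
  move=> [a b] /=; have [Aa|nAa] := pselect (A a); last by exists k0.
  have [Ab|nAb] := pselect (A b); last by exists k0.
  by have [c Zc] := tot a b Aa Ab; exists c.
have fA a b : A a -> A b -> A (f (a, b)).
  by move=> Aa Ab; have [] := sub _ _ _ (fP (a, b) Aa Ab).
have finj a b a' b' : A a -> A b -> A a' -> A b' ->
    f (a, b) = f (a', b') -> (a, b) = (a', b').
  move=> Aa Ab Aa' Ab' eqf; apply: (inj _ _ _ _ _ (fP (a, b) Aa Ab)).
  by rewrite eqf; exact: (fP (a', b') Aa' Ab').
have [/(card_le_injP _ _ k0)[h hA hinj]|/(card_le_injP _ _ k0)[h hA hinj]] :=
    card_le_total (~` A) A.
- pose g x := if pselect (A x) then f (e 0, x) else f (e 1, h x).
  have gA x : A (g x).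
    rewrite /g; case: pselect => Ax; first exact: fA.
    by apply: fA => //; exact: hA.
  have ginj : injective g.
    move=> x y; rewrite /g; case: pselect => Ax; case: pselect => Ay.
    + by move=> /(finj _ _ _ _ (Ae 0) Ax (Ae 0) Ay)[].
    + by move=> /(finj _ _ _ _ (Ae 0) Ax (Ae 1) (hA _ Ay))[/einj].
    + by move=> /(finj _ _ _ _ (Ae 1) (hA _ Ax) (Ae 0) Ay)[/einj].
    + move=> /(finj _ _ _ _ (Ae 1) (hA _ Ax) (Ae 1) (hA _ Ay))[].
      by apply: hinj; rewrite inE.
  apply: (@card_le_inj _ _ _ (fun p => f (g p.1, g p.2))).
  move=> [x y] [x' y'] _ _ /=.
  by move=> /(finj _ _ _ _ (gA x) (gA y) (gA x') (gA y'))[/ginj-> /ginj->].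
- pose B := h @` A.
  (* [r] retracts the union [D] of [A] and [B] onto [A]. *)
  have /choice[r rP] : forall x, exists a,
      (A x -> a = x) /\ (forall b, A b -> x = h b -> a = b).
    move=> x; have [Ax|nAx] := pselect (A x).
      by exists x; split => // b Ab xhb; have := hA _ Ab; rewrite -xhb.
    have [[b Ab hbx]|nBx] := pselect (B x).
      exists b; split => // b' Ab' xhb'; apply: hinj; rewrite ?inE//.
      by rewrite hbx.
    by exists x; split => // b Ab xhb; case: nBx; exists b.
  pose D := A `|` B.
  have rA x : D x -> A (r x).
    move=> [Ax|[b Ab hbx]]; first by rewrite (rP x).1.
    by rewrite ((rP x).2 b).
  have rinj x y : D x -> D y -> (A x <-> A y) -> r x = r y -> x = y.
    have [Ax _ _ [/(_ Ax) Ay _]|nAx] := pselect (A x).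
      by rewrite (rP x).1 // (rP y).1.
    move=> [//|[a Aa <-]] [Ay [_ /(_ Ay)/(hA _ Aa)]|[b Ab <-] _] //.
    by rewrite ((rP (h a)).2 a) // ((rP (h b)).2 b) // => ->.
  (* [code x y] records which of [x] and [y] lie in [A]. *)
  pose code x y :=
    if pselect (A x) then e 0 else if pselect (A y) then e 1 else e 2.
  have codeA x y : A (code x y).
    by rewrite /code; do 2?[case: pselect => ?]; exact: Ae.
  pose g x y := h (f (code x y, f (r x, r y))).
  have Af x y : D x -> D y -> A (f (code x y, f (r x, r y))).
    by move=> Dx Dy; exact: fA (codeA _ _) (fA _ _ (rA _ Dx) (rA _ Dy)).
  have gD x y : D x -> D y -> ~ (A x /\ A y) -> (D `\` A) (g x y).
    move=> Dx Dy _.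
    split; last exact: hA (Af _ _ Dx Dy).
    by right; exists (f (code x y, f (r x, r y))); first exact: Af.
  have ginj x y x' y' : D x -> D y -> ~ (A x /\ A y) ->
      D x' -> D y' -> ~ (A x' /\ A y') -> g x y = g x' y' -> (x, y) = (x', y').
    move=> Dx Dy nA Dx' Dy' nA'.
    move/(hinj _ _ (mem_set (Af _ _ Dx Dy)) (mem_set (Af _ _ Dx' Dy'))).
    have Ar := fA _ _ (rA _ Dx) (rA _ Dy).
    have Ar' := fA _ _ (rA _ Dx') (rA _ Dy').
    move=> /(finj _ _ _ _ (codeA _ _) Ar (codeA _ _) Ar')[eqc].
    move=> /(finj _ _ _ _ (rA _ Dx) (rA _ Dy) (rA _ Dx') (rA _ Dy'))[eqx eqy].
    have [Axx' Ayy'] : (A x <-> A x') /\ (A y <-> A y').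
      move: eqc; rewrite /code.
      case: (pselect (A x)) => ?; case: (pselect (A y)) => ?;
      case: (pselect (A x')) => ?; case: (pselect (A y')) => ?;
      by move=> /einj // _; tauto.
    by rewrite (rinj x x') // (rinj y y').
  have PZ' := pairing_graph_extend PZ (@subsetUl _ A B) gD ginj.
  exfalso; refine (Zmax _ _ (conj PZ' _)); last first.
    by move=> _; apply: (subset_trans Z0Z); exact: subsetUl.
  split; first exact: subsetUl.
  have Dh : D (h (e 0)) by right; exists (e 0).
  have nAh : ~ A (h (e 0)) by exact: hA.
  move=> Z'Z; apply: (nAh); exists (g (h (e 0)) (h (e 0))).
  by apply: Z'Z; right; split => // -[].
Qed.

End Square.

(** A sequence is determined by its length and by the iterated pairing of its
entries; the length is needed since the pairing may also take the value used
for the empty sequence. *)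
Lemma card_seq {K : Type} : infinite_set [set: K] ->
  ([set: seq K] #<= [set: K])%card.
Proof.
move=> Kinf.
have [k0 _] : [set: K] !=set0.
  by apply/set0P/eqP => K0; apply: Kinf; rewrite K0.
have /infiniteP/(card_le_injP _ _ k0)[e _ einj] := Kinf.
have [f _ finj] := card_le_injP _ _ k0 (card_square Kinf).
have {}einj : injective e by move=> m n; apply: einj; rewrite in_setT.
have {}finj : injective f by move=> m n; apply: finj; rewrite in_setT.
pose code := fix code s := if s is x :: s' then f (x, code s') else k0.
apply: (@card_le_inj _ _ _ (fun s => f (e (size s), code s))).
move=> s t _ _ /finj[/einj eqs].
elim: s t eqs => [|x s IH] [|y t] //= [/IH{}IH].
by move=> /finj[-> /IH->].
Qed.

Lemma card_le_bigcup {I T K : Type} (D : set I) (F : I -> set T) :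
  infinite_set [set: K] -> (D #<= [set: K])%card ->
  (forall i, D i -> F i #<= [set: K])%card ->
  (\bigcup_(i in D) F i #<= [set: K])%card.
Proof.
move=> Kinf DK FK.
have [k0 _] : [set: K] !=set0.
  by apply/set0P/eqP => K0; apply: Kinf; rewrite K0.
have [d _ dinj] := card_le_injP _ _ k0 DK.
have /choice[f finj] : forall i, exists f : T -> K, D i -> set_inj (F i) f.
  move=> i; have [Di|nDi] := pselect (D i); last by exists (fun=> k0).
  by have [f _ finj] := card_le_injP _ _ k0 (FK i Di); exists f.
have [->|/set0P[x0 [i0 _ _]]] := eqVneq (\bigcup_(i in D) F i) set0.
  exact: card_ge0.
have /choice[ix ixP] : forall x, exists i,
    (\bigcup_(i in D) F i) x -> D i /\ F i x.
  move=> x; have [[i Di Fix]|nx] := pselect ((\bigcup_(i in D) F i) x).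
    by exists i.
  by exists i0.
apply: card_le_trans (card_square Kinf).
apply: (@card_le_inj _ _ _ (fun x => (d (ix x), f (ix x) x))).
move=> x y /set_mem/ixP[Dx Fx] /set_mem/ixP[Dy Fy] [/dinj eqi].
have {}eqi : ix x = ix y by apply: eqi; rewrite inE.
by move: Fy; rewrite -eqi => Fy; apply: finj => //; rewrite inE.
Qed.

(** * Discrete sets *)

Section DiscreteSets.
Context {X : topologicalType}.
Context (X_hausdorff : hausdorff_space X).
Implicit Types D E G P S U V W : set X.

Definition remainder D := closure D `\` D.

Lemma open_setD {U G} : open U -> closed G -> open (U `\` G).
Proof.
by move=> oU cG; rewrite setDE; apply: openI => //; exact: closed_openC.
Qed.

Lemma discrete_setP {D} {x : X} : discrete_set D -> D x ->
  exists W, [/\ open W, W x & W `&` D `<=` [set x]].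
Proof.
move=> Dd Dx; have [W oW WD] := Dd [set exist _ x (mem_set Dx)].
exists W; split => //.
  by rewrite -[W x]/((set_val @^-1` W) (exist _ x (mem_set Dx))) WD.
move=> y [Wy Dy].
have : (set_val @^-1` W) (exist _ y (mem_set Dy)) by [].
by rewrite WD => -[].
Qed.

Lemma discrete_set_subset {D E} : discrete_set D -> E `<=` D -> discrete_set E.
Proof.
move=> Dd ED B; pose F := [set V : set X | open V /\ V `&` E `<=` set_val @` B].
exists (\bigcup_(V in F) V); first by apply: bigcup_open => V [].
apply/seteqP; split => [y [V [_ VB] Vy]|y By].
  have [|b Bb by_] := VB (set_val y); first by split => //; exact: set_valP.
  by rewrite -(val_inj by_).
have Ey := set_valP y.
have [W [oW Wy WD]] := discrete_setP Dd (ED _ Ey).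
exists W => //; split => // z [Wz /ED Dz].
by exists y => //; rewrite (WD z).
Qed.

Lemma discrete_subset_closed {D S} {x : X} : discrete_set D -> S `<=` D ->
  D x -> closure S x -> S x.
Proof.
move=> Dd SD Dx clS; have [W [oW Wx WD]] := discrete_setP Dd Dx.
have [y [Sy Wy]] := clS _ (open_nbhs_nbhs (conj oW Wx)).
by rewrite -(WD y) //; split => //; exact: SD.
Qed.

(** A point of [D] has a neighborhood with no other point of [D], hence, points
being closed, with no other point of [closure D]: [D] is open in its closure. *)
Lemma closed_remainder {D} : discrete_set D -> closed (remainder D).
Proof.
move=> Dd x clx; have clDx : closure D x.
  by apply: (@closed_closure _ D); apply: closureS clx => y [].
split => // Dx; have [W [oW Wx WD]] := discrete_setP Dd Dx.
have [y [[clDy nDy] Wy]] := clx _ (open_nbhs_nbhs (conj oW Wx)).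
have oWx : open (W `\` [set x]).
  apply: open_setD => //; exact/accessible_closed_set1/hausdorff_accessible.
have Wxy : (W `\` [set x]) y by split => // yx; apply: nDy; rewrite yx.
have [z [Dz [Wz nzx]]] := clDy _ (open_nbhs_nbhs (conj oWx Wxy)).
by apply: nzx; exact: WD.
Qed.

(** The intersection is closed, because a limit point outside [D] would be in
the remainder; were it infinite, its cofinite subsets would generate a proper
filter, clustering at a point of [D] that is not isolated in [D]. *)
Lemma compact_discrete_finite {D G} : compact [set: X] -> discrete_set D ->
  closed G -> G `&` remainder D = set0 -> finite_set (G `&` D).
Proof.
move=> Xc Dd Gcl GD0; apply: contrapT => Qinf; set Q := G `&` D in Qinf.
pose F : set_system X := [set A | finite_set (Q `\` A)].
have FF : ProperFilter F.
  split; first by rewrite /F /= setD0.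
  split; first by rewrite /F /= setDT.
    by move=> A B FA FB; rewrite /F /= setDIr finite_setU.
  by move=> A B AB; apply: sub_finite_set; exact: setDS.
have [|x [_ clx]] := Xc F FF; first exact: filterT.
have FQ : F Q by rewrite /F /= setDv.
have Gx : G x.
  by apply: Gcl => A Ax; have [y [[Gy _] Ay]] := clx Q A FQ Ax; exists y.
have clDx : closure D x.
  by move=> A Ax; have [y [[_ Dy] Ay]] := clx Q A FQ Ax; exists y.
have Dx : D x.
  by apply: contrapT => nDx; have : set0 x by rewrite -GD0.
have [W [oW Wx WD]] := discrete_setP Dd Dx.
have FQx : F (Q `\` [set x]).
  apply: (@sub_finite_set _ _ [set x]) => // y [Qy nQy].
  by apply: contrapT => nyx; apply: nQy.
have [y [[[_ Dy] nyx] Wy]] := clx _ _ FQx (open_nbhs_nbhs (conj oW Wx)).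
by apply: nyx; exact: WD.
Qed.

Lemma open_shrink {U P} : compact [set: X] -> open U -> ~ U `<=` closure P ->
  exists V, [/\ open V, V !=set0 & closure V `<=` U `\` P].
Proof.
move=> Xc oU /existsNP[x /not_implyP[Ux nPx]].
have oW : open (U `\` closure P).
  by apply: open_setD => //; exact: closed_closure.
have Wx : nbhs x (U `\` closure P) by apply: open_nbhs_nbhs; split.
have [B Bx BW] := compact_regular X_hausdorff Xc (filterT : nbhs x setT) Wx.
exists B°; split; [exact: open_interior|by exists x|].
move=> y /(closureS (@interior_subset _ B)) /BW[Uy nPy]; split => // Py.
by apply: nPy; exact: subset_closure.
Qed.

(** If [U] meets the first set [D] at [y], isolate [y] in [D] by an open set:
its intersection with [U], once [y] is removed, is either empty or an open set
covered by the other sets. *)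
Lemma finite_discrete_cover_isolated (s : seq (set X)) U :
  (forall D, D \in s -> discrete_set D) -> open U -> U !=set0 ->
  (forall x, U x -> exists2 D, D \in s & D x) ->
  exists x : X, open [set x].
Proof.
elim: s U => [|D s IH] U sd oU [x Ux] Us; first by have [] := Us x Ux.
have sd' E : E \in s -> discrete_set E.
  by move=> Es; apply: sd; rewrite inE Es orbT.
have [[y [Uy Dy]]|UD0] := pselect (U `&` D !=set0); last first.
  apply: (IH U) => //; first by exists x.
  move=> z Uz; have [E] := Us z Uz; rewrite inE => /orP[/eqP->Dz|Es Ez].
    by case: UD0; exists z.
  by exists E.
have [|W [oW Wy WD]] := discrete_setP _ Dy.
  by apply: sd; rewrite inE eqxx.
pose V := (U `&` W) `\` [set y].
have oV : open V.
  apply: open_setD; first exact: openI.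
  exact/accessible_closed_set1/hausdorff_accessible.
have [V0|nV0] := pselect (V !=set0).
  apply: (IH V) => // z [[Uz Wz] nzy]; have [E] := Us z Uz.
  rewrite inE => /orP[/eqP->Dz|Es Ez]; last by exists E.
  by case: nzy; exact: WD.
exists y; suff -> : [set y] = U `&` W by exact: openI.
apply/seteqP; split => [_ -> //|z UWz].
by apply: contrapT => nzy; apply: nV0; exists z.
Qed.

(** Jones' lemma: normality is applied to [Y], the subspace of [U] in which the
discrete set [E] is closed. *)
Lemma discrete_density {U P D} : T5_space X -> open U ->
  U `<=` closure P -> discrete_set D ->
  card_leq (pow2 (D `&` U)) (pow2 P).
Proof.
move=> [_ XT5] oU UP Dd; set E := D `&` U.
have Ed : discrete_set E by apply: discrete_set_subset Dd _ => x [].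
pose Y := U `\` remainder E.
have oY : open Y by apply: open_setD => //; exact: closed_remainder.
have EY : E `<=` Y by move=> x Ex; split; [case: Ex|case].
have clY S : S `<=` E -> closed (set_val @^-1` S : set (set_type Y)).
  move=> SE; rewrite -openC; exists (~` closure S).
    exact/closed_openC/closed_closure.
  apply/seteqP; split => [[x xY] nSx Sx|[x xY] nSx clSx].
    by apply: nSx; exact: subset_closure.
  apply: nSx; have [Ux nEx] := set_mem xY.
  apply: (discrete_subset_closed Ed SE) => //.
  by apply: contrapT => nE; apply: nEx; split => //; exact: closureS clSx.
have /choice[V VP] : forall S, exists V, S `<=` E ->
    [/\ open V, V `<=` U, S `<=` V & closure V `&` E `<=` S].
  move=> S; have [SE|nSE] := pselect (S `<=` E); last by exists set0.
  have nE : set_nbhs (set_val @^-1` S)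
      (~` (set_val @^-1` (E `\` S)) : set (set_type Y)).
    apply/set_nbhsP; exists (~` (set_val @^-1` (E `\` S))); split => //.
      by rewrite openC; apply: clY => x [].
    by move=> x Sx [].
  have [B /set_nbhsP[_ [[W oW <-] SW WB] clB]] := XT5 Y _ (clY S SE) _ nE.
  exists (W `&` Y) => _; split.
  - exact: openI.
  - by move=> x [_ [? _]].
  - move=> x Sx; have Yx := EY _ (SE _ Sx); split=> //.
    exact: (SW (exist _ x (mem_set Yx))).
  - move=> x [clx Ex]; apply: contrapT => nSx.
    apply: (clB (exist _ x (mem_set (EY _ Ex)))) => // N.
    rewrite nbhsE => -[_ [[Q oQ <-] Qx] QN].
    have [y [[Wy Yy] Qy]] := clx _ (open_nbhs_nbhs (conj oQ Qx)).
    exists (exist _ y (mem_set Yy)); split; [exact: WB|exact: QN].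
pose f (S : set (set_type E)) : set (set_type P) :=
  [set p | V (set_val @` S) (set_val p)].
have VE (S : set (set_type E)) : set_val @` S `<=` E.
  by move=> _ [x _ <-]; exact: set_valP.
apply: (@card_le_inj _ _ _ f) => S S' _ _.
suff sub (S1 S2 : set (set_type E)) : f S1 = f S2 -> S1 `<=` S2.
  by move=> eqf; apply/seteqP; split; apply: sub.
move=> eqf x S1x.
have [oV VU SV _] := VP _ (VE S1); have [_ _ _ V2] := VP _ (VE S2).
have [|y S2y eqxy] := V2 (set_val x); last by rewrite -(val_inj eqxy).
split; last exact: set_valP.
(* As [P] is dense in [U], the open set attached to [S1] lies in the closure
of its trace on [P], which is also the trace of the one attached to [S2]. *)
move=> W Wx.
have V1x : V (set_val @` S1) (set_val x) by apply: SV; exists x.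
have WVx : nbhs (set_val x) (W `&` V (set_val @` S1)).
  by apply: filterI => //; apply: open_nbhs_nbhs.
have [p [Pp [Wp V1p]]] := UP _ (VU _ V1x) _ WVx.
exists p; split => //.
have : f S1 (exist _ p (mem_set Pp)) by [].
by rewrite eqf.
Qed.

End DiscreteSets.

Lemma discrete_set1 {X : topologicalType} (x : X) : discrete_set [set x].
Proof.
move=> B; have [[b Bb]|B0] := pselect (B !=set0).
  exists [set: X]; first exact: openT.
  apply/seteqP; split => // y _; suff -> : y = b by [].
  by apply: val_inj; rewrite (set_valP y) (set_valP b).
exists set0; first exact: open0.
by apply/seteqP; split => // y By; case: B0; exists y.
Qed.

(** * Compact spaces covered by few discrete sets *)

Section DiscreteCover.
Context {X : topologicalType} {K : choiceType} (D : K -> set X).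
Context (X_hausdorff : hausdorff_space X) (X_compact : compact [set: X]).
Context (D_discrete : forall k, discrete_set (D k)).
Implicit Types (A : set K) (s : seq K) (G : set X).

Definition remainders s : set X := \bigcap_(k in [set` s]) remainder (D k).

(** The sets of this union are finite when [G] is closed, by
[compact_discrete_finite]. *)
Definition finite_traces G : set X :=
  \bigcup_(i in [set i : seq K * K |
      G `&` remainders i.1 `&` remainder (D i.2) = set0])
    (G `&` remainders i.1 `&` D i.2).

Lemma closed_remainders s : closed (remainders s).
Proof. by apply: closed_bigI => k _; exact: closed_remainder. Qed.

Lemma card_finite_traces {G} : closed G -> infinite_set [set: K] ->
  (finite_traces G #<= [set: K])%card.
Proof.
move=> clG Kinf; apply: card_le_bigcup => // [|i Gi0].
  apply: (card_le_trans (card_leT _)).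
  apply: card_le_trans (card_square Kinf).
  have [k0 _] : [set: K] !=set0.
    by apply/set0P/eqP => K0; apply: Kinf; rewrite K0.
  have [f _ finj] := card_le_injP _ _ k0 (card_seq Kinf).
  apply: (@card_le_inj _ _ _ (fun i : seq K * K => (f i.1, i.2))).
  by move=> [s k] [t l] _ _ /= [/finj + ->] => ->//; rewrite inE.
apply: (card_le_trans (finite_set_countable _)); last exact/infiniteP.
have clGi := closedI clG (closed_remainders i.1).
exact: compact_discrete_finite X_compact (D_discrete _) clGi Gi0.
Qed.

(** Let [A] be a maximal set of indices such that the closures of the [U n] and
the remainders of the [D k] with [k] in [A] have the finite intersection
property, and let [x] be a common point of all these closed sets.  If [D k]
contains [x], then [k] is not in [A], so that the remainder of [D k] is disjoint
from the intersection of the closure of some [U n] and of finitely many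
remainders indexed by [A].  Then [x] is in [finite_traces (closure (U n))],
which does not meet the closure of [U n.+1]. *)
Lemma descent_escapes_cover (U : nat -> set X) :
  (forall n, U n !=set0) ->
  (forall n, closure (U n.+1) `<=` U n `\` finite_traces (closure (U n))) ->
  \bigcup_k D k <> [set: X].
Proof.
move=> U0 Ustep Dcov.
have Ule m n : (m <= n)%N -> closure (U n) `<=` closure (U m).
  move=> /subnK <-; elim: (n - m)%N => [//|d IH].
  apply: subset_trans IH => x /Ustep[Ux _]; exact: subset_closure.
pose FIP A := forall n s, (forall k, k \in s -> A k) ->
  closure (U n) `&` remainders s !=set0.
have [|A [AF Amax]] := @Zorn_bigcup K FIP.
  move=> F FF Ftot n s sF.
  (* The finitely many indices in [s] belong to one member of the chain. *)
  have [A FA sA] : exists2 A, (F A \/ A = set0) & forall k, k \in s -> A k.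
    elim: s sF => [|k s IH] sF; first by exists set0; [right|].
    have [|A FA sA] := IH; first by move=> l ls; apply: sF; rewrite inE ls orbT.
    have [B FB Bk] := sF k (mem_head _ _).
    have {}FA : A `<=` B \/ F A /\ B `<=` A.
      move: FA => [FA|->]; last by left.
      by have [AB|BA] := Ftot _ _ FA FB; [left|right].
    have {FA}[AB|[FA BA]] := FA.
      exists B; first by left.
      by move=> l; rewrite inE => /orP[/eqP->//|/sA/AB].
    exists A; first by left.
    by move=> l; rewrite inE => /orP[/eqP->|/sA//]; exact: BA.
  move: FA sA => [FA|->] sA; first exact: FF FA n s sA.
  have [x Ux] := U0 n; exists x; split; first exact: subset_closure.
  by move=> k /= /sA.
have [x Ux] : exists x, forall n s, (forall k, k \in s -> A k) ->
    (closure (U n) `&` remainders s) x.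
  pose F : set_system X := filter_from
    [set i : nat * seq K | forall k, k \in i.2 -> A k]
    (fun i => closure (U i.1) `&` remainders i.2).
  have FF : ProperFilter F.
    apply: filter_from_proper => [|[n s] sA]; last exact: AF.
    apply: filter_from_filter; first by exists (0%N, [::]).
    move=> [m s] [n t] /= sA tA; exists (maxn m n, s ++ t) => /=.
      by move=> k; rewrite mem_cat => /orP[/sA|/tA].
    move=> x [clx stx]; split; split.
    - exact: Ule (leq_maxl m n) _ clx.
    - by move=> k /= ks; apply: stx; rewrite /= mem_cat ks.
    - exact: Ule (leq_maxr m n) _ clx.
    - by move=> k /= kt; apply: stx; rewrite /= mem_cat kt orbT.
  have [|x [_ clx]] := X_compact _ FF; first exact: filterT.
  exists x => n s sA.
  have cl : closed (closure (U n) `&` remainders s).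
    by apply: closedI; [exact: closed_closure|exact: closed_remainders].
  by apply: cl => B Bx; apply: clx => //; exists (n, s).
have [k _ Dkx] : (\bigcup_k D k) x by rewrite Dcov.
have nAk : ~ A k.
  move=> Ak; have [|_ /(_ k)[]] := Ux 0%N [:: k]; last by move=> _; apply.
    by move=> l; rewrite inE => /eqP->.
  by rewrite /= mem_head.
have [n [s [sA Us0]]] : exists n s, (forall l, l \in s -> A l \/ l = k) /\
    closure (U n) `&` remainders s = set0.
  apply: contrapT => nex; apply: (Amax (A `|` [set k])).
    split; first exact: subsetUl.
    by move=> /(_ k) kA; apply: nAk; apply: kA; right.
  move=> n s sA; apply/set0P/eqP => Us0; apply: nex.
  by exists n, s.
pose t := [seq l <- s | l != k].
have tA l : l \in t -> A l.
  by rewrite mem_filter => /andP[/eqP lk /sA[]].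
have Ut0 : closure (U n) `&` remainders t `&` remainder (D k) = set0.
  rewrite -subset0 -Us0 => y [[Uy ty] Ry]; split => // l /= ls.
  have [->//|lk] := eqVneq l k.
  by apply: ty; rewrite /= mem_filter lk.
have [Unx _] := Ux n.+1 [::] (fun=> ltac:(done)).
have [_] := Ustep _ _ Unx; apply; exists (t, k) => //.
by split => //; exact: Ux.
Qed.

Lemma small_dense_open : [set: X] !=set0 -> infinite_set [set: K] ->
  \bigcup_k D k = [set: X] ->
  exists U P : set X, [/\ open U, U !=set0, (P #<= [set: K])%card &
    U `<=` closure P].
Proof.
move=> X0 Kinf Dcov; apply: contrapT => nUP.
have /choice[next nextP] : forall U : set X, exists V, open U -> U !=set0 ->
    [/\ open V, V !=set0 & closure V `<=` U `\` finite_traces (closure U)].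
  move=> U; have [[oU U0]|nU] := pselect (open U /\ U !=set0); last first.
    by exists set0 => oU U0; case: nU.
  have [|V VP] := open_shrink (P := finite_traces (closure U))
      X_hausdorff X_compact oU.
    move=> UP; apply: nUP; exists U, (finite_traces (closure U)); split => //.
    by apply: card_finite_traces => //; exact: closed_closure.
  by exists V.
pose U n := iter n next [set: X].
have UP n : open (U n) /\ U n !=set0.
  elim: n => [|n [oU U0]]; first by split => //; exact: openT.
  by have [] := nextP _ oU U0.
apply: (descent_escapes_cover U (fun n => (UP n).2)) Dcov => n.
by have [oU U0] := UP n; have [] := nextP _ oU U0.
Qed.

End DiscreteCover.

(** * The inequality *)

Theorem theorem2p7
  (pow2_lt : forall K L : cardinal,
     is_succ_card K L -> card_ltn (pow2 K) (pow2 L))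
  (X : topologicalType)
  (X_nonempty : [set: X] !=set0)
  (X_compact : compact [set: X])
  (X_T5 : T5_space X) :
  card_leq (Delta X) (dis X).
Proof.
have X_hausdorff := X_T5.1.
have [] := @least_card_setP _ (@discrete_covers X).
  exists [set [set x] | x in [set: X]]; split.
    move=> _ [x _ <-]; exact: discrete_set1.
  by apply/seteqP; split => // x _; exists [set x] => //; exists x.
rewrite /dis /least_card; set C := least_card_set _ => -[Cd Ccov] _.
pose opens := [set U : set X | open U /\ U !=set0].
have DeltaP (U : set X) : open U -> U !=set0 ->
    (least_card_set opens #<= U)%card.
  move=> oU U0; have [_] := least_card_setP (ex_intro opens U (conj oU U0)).
  by apply.
rewrite /card_leq /Delta /least_card.
rewrite (card_le_eql (card_setT _)).
pose D (k : set_type C) : set X := set_val k.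
have Dd k : discrete_set (D k) by apply: Cd; exact: set_valP.
have Dcov : \bigcup_k D k = [set: X].
  rewrite -Ccov; apply/seteqP; split => [x [k _ Dkx]|x [E CE Ex]].
    by exists (D k) => //; exact: set_valP.
  by exists (exist _ E (mem_set CE)).
have [Cfin|Cinf] := pselect (finite_set C).
  have [s sC] := (finite_seqP _).1 Cfin.
  have [x ox] : exists x : X, open [set x].
    apply: (finite_discrete_cover_isolated X_hausdorff s [set: X]) => //.
    - by move=> E Es; apply: Cd; rewrite sC.
    - exact: openT.
    - by move=> x; rewrite -Ccov sC => -[E]; exists E.
  apply: card_le_trans (DeltaP _ ox (ex_intro _ x erefl)) _.
  rewrite (card_le_eqr (card_setT _)).
  have [E CE Ex] : (\bigcup_(E in C) E) x by rewrite Ccov.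
  apply: (@card_le_trans _ _ _ [set E]); last by apply: subset_card_le => _ ->.
  have : ([set x] #= [set E])%card.
    by rewrite (card_eql card_set1) (card_eqr card_set1).
  by rewrite card_eq_le => /andP[].
have Kinf : infinite_set [set: set_type C].
  apply: contra_not Cinf; apply: card_le_finite.
  by rewrite (card_le_eqr (card_setT _)).
have [U [P [oU U0 PK UP]]] :=
  small_dense_open D X_hausdorff X_compact Dd X_nonempty Kinf Dcov.
apply: card_le_trans (DeltaP U oU U0) _.
have -> : U = \bigcup_k (D k `&` U).
  by rewrite -setI_bigcupl Dcov setTI.
apply: card_le_bigcup => // k _; apply: contrapT => nDU.
have [B [Bsucc BDU]] := card_le_succ_within _ nDU.
have [_ ] := pow2_lt _ _ Bsucc; apply.
apply: (@card_le_trans _ _ _ [set: pow2 (set_type (D k `&` U))]).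
  apply: card_leq_pow2.
  by rewrite /card_leq (card_le_eql (card_setT _)) (card_le_eqr (card_setT _)).
apply: (card_le_trans (discrete_density X_hausdorff X_T5 oU UP (Dd k))).
apply: card_leq_pow2.
by rewrite /card_leq (card_le_eql (card_setT _)).
Qed.
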